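(* Let $n\ge 3$, let $q_1,\dots,q_n\in\mathbb{H}$ with $q_1\neq 0$, and let $f_r(z)=z^n+z^{n-1}q_n+\cdots+zq_2+q_1$. Put $q_{-1}=q_0=0$ and $$\alpha=\sum_{j=1}^{n}\left|q_jq_{n-1}-q_jq_n^2+q_{j-1}q_n-q_{j-2}\right|^2,\qquad \beta=\sum_{j=1}^{n}\left|q_jq_n-q_{j-1}\right|^2.$$ If $z\in\mathbb{H}$ is a zero of $f_r$, then $$|z|\le\left(1+\alpha+\beta+\sum_{j=1}^{n}|q_j|^2\right)^{1/6}.$$
   Context: $\mathbb{H}$ is the real quaternion division algebra, and $|a+bi+cj+dk|=\sqrt{a^2+b^2+c^2+d^2}$. The polynomial $f_r$ has its coefficients written on the right of the powers of $z$; a zero of $f_r$ is a quaternion $z$ with $z^n+z^{n-1}q_n+\cdots+zq_2+q_1=0$ (direct evaluation in $\mathbb{H}$). *)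

(* Defs.v *)
From HB Require Import structures.
From mathcomp Require Import all_boot all_order all_algebra.
From mathcomp Require Import ring.
From mathcomp Require Import reals exp.
Set Implicit Arguments.
Unset Strict Implicit.
Unset Printing Implicit Defensive.
Import Order.TTheory GRing.Theory Num.Theory.
Local Open Scope ring_scope.

(* [Quat a b c d] is a + b i + c j + d k; [R] is an arbitrary model of the
   real numbers. *)
Record quat (R : realType) : Type := Quat { qa : R; qb : R; qc : R; qd : R }.

Section QuaternionRing.
Variable R : realType.
Local Notation H := (quat R).

Definition quat_to_prod (x : H) : R * R * R * R := (qa x, qb x, qc x, qd x).
Definition quat_of_prod (p : R * R * R * R) : H :=
  let: (a, b, c, d) := p in Quat a b c d.
Lemma quat_to_prodK : cancel quat_to_prod quat_of_prod.
Proof. by case. Qed.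

HB.instance Definition _ := Equality.copy H (can_type quat_to_prodK).
HB.instance Definition _ := Choice.copy H (can_type quat_to_prodK).

Definition addq (x y : H) : H :=
  Quat (qa x + qa y) (qb x + qb y) (qc x + qc y) (qd x + qd y).
Definition oppq (x : H) : H := Quat (- qa x) (- qb x) (- qc x) (- qd x).

Lemma addqA : associative addq.
Proof. by move=> x y z; rewrite /addq /= !addrA. Qed.
Lemma addqC : commutative addq.
Proof.
by move=> x y; rewrite /addq (addrC (qa x)) (addrC (qb x)) (addrC (qc x))
  (addrC (qd x)).
Qed.
Lemma add0q : left_id (Quat 0 0 0 0) addq.
Proof. by case=> a b c d; rewrite /addq /= !add0r. Qed.
Lemma addNq : left_inverse (Quat 0 0 0 0) oppq addq.
Proof. by case=> a b c d; rewrite /addq /= !addNr. Qed.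

HB.instance Definition _ := GRing.isZmodule.Build H addqA addqC add0q addNq.

(* Hamilton product: i^2 = j^2 = k^2 = ijk = -1. *)
Definition mulq (x y : H) : H :=
  let: Quat a1 b1 c1 d1 := x in let: Quat a2 b2 c2 d2 := y in
  Quat (a1 * a2 - b1 * b2 - c1 * c2 - d1 * d2)
       (a1 * b2 + b1 * a2 + c1 * d2 - d1 * c2)
       (a1 * c2 - b1 * d2 + c1 * a2 + d1 * b2)
       (a1 * d2 + b1 * c2 - c1 * b2 + d1 * a2).

Lemma mulqA : associative mulq.
Proof. by move=> [????] [????] [????]; congr Quat; ring. Qed.
Lemma mul1q : left_id (Quat 1 0 0 0) mulq.
Proof. by move=> [????]; congr Quat; ring. Qed.
Lemma mulq1 : right_id (Quat 1 0 0 0) mulq.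
Proof. by move=> [????]; congr Quat; ring. Qed.
Lemma mulqDl : left_distributive mulq +%R.
Proof. by move=> [????] [????] [????]; congr Quat => /=; ring. Qed.
Lemma mulqDr : right_distributive mulq +%R.
Proof. by move=> [????] [????] [????]; congr Quat => /=; ring. Qed.
Lemma oneq_neq0 : Quat 1 0 0 0 != 0 :> H.
Proof. by apply/eqP=> -[] /eqP; rewrite oner_eq0. Qed.

HB.instance Definition _ := GRing.Zmodule_isNzRing.Build H
  mulqA mul1q mulq1 mulqDl mulqDr oneq_neq0.

End QuaternionRing.

Definition qnorm (R : realType) (x : quat R) : R :=
  Num.sqrt (qa x ^+ 2 + qb x ^+ 2 + qc x ^+ 2 + qd x ^+ 2).

(* The coefficients are indexed by integers, so that the indices j - 1 and
   j - 2, which reach 0 and -1, involve no truncated subtraction.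
   [{poly _}] is not used: its [p.[x]] evaluates with the coefficients on the
   left of the powers of x. *)
Definition fr (R : realType) (n : nat) (q : int -> quat R) (z : quat R) :
    quat R :=
  z ^+ n + \sum_(1 <= j < n.+1) z ^+ j.-1 * q j%:Z.

Definition alpha (R : realType) (n : nat) (q : int -> quat R) : R :=
  \sum_(1 <= j < n.+1)
    qnorm (q j%:Z * q (n%:Z - 1) - q j%:Z * q n%:Z ^+ 2
           + q (j%:Z - 1) * q n%:Z - q (j%:Z - 2)) ^+ 2.

Definition beta (R : realType) (n : nat) (q : int -> quat R) : R :=
  \sum_(1 <= j < n.+1) qnorm (q j%:Z * q n%:Z - q (j%:Z - 1)) ^+ 2.

(* Main.v *)
Require Import Defs.
From mathcomp Require Import all_boot all_order all_algebra.
From mathcomp Require Import ring.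
From mathcomp Require Import reals exp.
Import Order.TTheory GRing.Theory Num.Theory.
Local Open Scope ring_scope.

(** A zero [z] turns multiplication by [z] into the action of the companion
    matrix [C] of the polynomial on the vector [v = (1, z, ..., z^(n-1))], so
    [z^3 v = C^3 v].  Of the [n] entries of [z^3 v], the first [n - 3] are again
    entries of [v], which accounts for the summand [1] of the bound; the last
    three are [z^n], [z^(n+1)], [z^(n+2)].  Replacing [z^n] by
    [- sum z^(j-1) q_j] once, twice and three times ([powcomb_shift]) writes
    these three as combinations of the entries of [v], and the coefficients are,
    up to sign, exactly the quaternions whose squared norms are summed in
    [sum |q_j|^2], [beta] and [alpha].  Cauchy-Schwarz over the quaternions
    ([normsq_sum_mul]) bounds each of the three by such a sum times [|v|^2], whence
    [|z|^6 |v|^2 <= (1 + alpha + beta + sum |q_j|^2) |v|^2], and [|v|^2] is at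
    least [1]. *)

(** * The squared norm of a quaternion *)

(** Working with [|x|^2], a polynomial in the coordinates, turns every norm
    estimate into a polynomial identity together with a sum of squares. *)
Definition normsq {R : realType} (x : quat R) : R :=
  qa x ^+ 2 + qb x ^+ 2 + qc x ^+ 2 + qd x ^+ 2.

Lemma normsq_ge0 (R : realType) (x : quat R) : 0 <= normsq x.
Proof. by rewrite /normsq !addr_ge0 ?sqr_ge0. Qed.

Lemma qnorm_sqr (R : realType) (x : quat R) : qnorm x ^+ 2 = normsq x.
Proof. by rewrite sqr_sqrtr // normsq_ge0. Qed.

Lemma normsq0 (R : realType) : normsq (0 : quat R) = 0.
Proof. by rewrite /normsq /= expr0n !addr0. Qed.

Lemma normsq0_eq0 (R : realType) (x : quat R) : normsq x = 0 -> x = 0.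
Proof.
case: x => a b c d /eqP; rewrite /normsq /=.
rewrite !paddr_eq0 ?addr_ge0 ?sqr_ge0 // !sqrf_eq0.
by move=> /andP[/andP[/andP[/eqP-> /eqP->] /eqP->] /eqP->].
Qed.

Lemma normsqN (R : realType) (x : quat R) : normsq (- x) = normsq x.
Proof. by case: x => a b c d; rewrite /normsq /= !sqrrN. Qed.

Lemma normsqM (R : realType) (x y : quat R) :
  normsq (x * y) = normsq x * normsq y.
Proof. by case: x y => [????] [????]; rewrite /normsq /=; ring. Qed.

Lemma normsqX (R : realType) (x : quat R) k : normsq (x ^+ k) = normsq x ^+ k.
Proof.
elim: k => [|k IHk]; last by rewrite !exprS normsqM IHk.
by rewrite !expr0 /normsq /= expr1n expr0n !addr0.
Qed.

(** The inductive step of Cauchy-Schwarz.  For [A > 0], multiplied by [A] the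
    difference of the two sides is at least
    [a |X|^2 - 2 A <X, x y> + A^2 |y|^2] with [a = |x|^2], and this is
    [|x^* X - A y|^2] because left multiplication by the conjugate [x^*] is
    adjoint to left multiplication by [x]. *)
Lemma normsq_add_mul (R : realType) (X x y : quat R) (A B : R) :
  0 <= A -> 0 <= B -> normsq X <= A * B ->
  normsq (X + x * y) <= (A + normsq x) * (B + normsq y).
Proof.
move=> A0 B0 hX; have [A_eq0|A_gt0] := eqVneq A 0.
  have -> : X = 0.
    by apply/normsq0_eq0/le_anti; rewrite normsq_ge0 andbT -(mul0r B) -A_eq0.
  rewrite A_eq0 !add0r normsqM ler_wpM2l ?normsq_ge0 //.
  by rewrite lerDr.
have {}A_gt0 : 0 < A by rewrite lt0r A_gt0.
rewrite -(ler_pM2l A_gt0).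
pose xs := Quat (qa x) (- qb x) (- qc x) (- qd x).
pose V := xs * X - Quat A 0 0 0 * y.
have key : (A + normsq x) * (normsq X + A * normsq y) =
           A * normsq (X + x * y) + normsq V.
  rewrite /V /xs {V xs}; case: X x y {hX} => [????] [????] [????].
  by rewrite /normsq /=; ring.
apply: (@le_trans _ _ ((A + normsq x) * (normsq X + A * normsq y))).
  by rewrite key lerDl normsq_ge0.
rewrite [leRHS]mulrCA; apply: ler_wpM2l; last by rewrite [leRHS]mulrDr lerD2r.
exact: addr_ge0 A0 (normsq_ge0 _ x).
Qed.

Lemma normsq_sum_mul (R : realType) (n : nat) (x y : nat -> quat R) :
  normsq (\sum_(i < n) x i * y i) <=
  (\sum_(i < n) normsq (x i)) * \sum_(i < n) normsq (y i).
Proof.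
elim: n => [|n IHn]; first by rewrite !big_ord0 normsq0 mul0r.
rewrite !big_ord_recr /=.
by apply: normsq_add_mul => //; apply: sumr_ge0 => i _; apply: normsq_ge0.
Qed.

(** * Powers of a zero as combinations of lower powers *)

(** The coefficient of [z ^+ i] is [c (i + 1)], the numbering of the
    coefficients of the polynomial. *)
Definition powcomb {R : realType} (n : nat) (z : quat R) (c : int -> quat R) :
    quat R :=
  \sum_(i < n) z ^+ i * c i.+1%:Z.

(** One application of the companion matrix: multiplication by [z] shifts the
    coefficients, and the power [z ^+ n] that overflows is replaced through the
    equation satisfied by [z].  The condition [c 0 = 0] says that nothing is
    shifted into the constant term. *)
Lemma powcomb_shift (R : realType) (n : nat) (q c : int -> quat R)
    (z : quat R) :
  z ^+ n = - powcomb n z q -> c 0 = 0 ->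
  z * powcomb n z c = powcomb n z (fun j => c (j - 1) - q j * c n%:Z).
Proof.
move=> hz c0.
have -> : z * powcomb n z c = \sum_(i < n.+1) z ^+ i * c i%:Z.
  rewrite big_ord_recl /= c0 mulr0 add0r /powcomb mulr_sumr.
  by apply: eq_bigr => i _; rewrite mulrA -exprS.
rewrite big_ord_recr /= hz mulNr /powcomb mulr_suml -sumrB.
apply: eq_bigr => i _.
by rewrite mulrBr mulrA; congr (_ * c _ - _); rewrite -addn1 PoszD addrK.
Qed.

Lemma normsq_powcomb (R : realType) (n : nat) (z : quat R)
    (c : int -> quat R) :
  normsq (powcomb n z c) <=
  (\sum_(i < n) normsq z ^+ i) * \sum_(1 <= j < n.+1) normsq (c j%:Z).
Proof.
rewrite big_add1 big_mkord; under eq_bigr do rewrite -normsqX.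
exact: (normsq_sum_mul _ _ (fun i => z ^+ i) (fun i => c i.+1%:Z)).
Qed.

Lemma fr_eq0 (R : realType) (n : nat) (q : int -> quat R) (z : quat R) :
  fr n q z = 0 -> z ^+ n = - powcomb n z q.
Proof. by move/eqP; rewrite /fr big_add1 big_mkord addr_eq0 => /eqP. Qed.

(** The coefficients of [z ^+ n.+1] and [z ^+ n.+2] come out in closed form
    because [q 0] and [q (-1)] vanish, as [powcomb_shift] requires. *)
Lemma zero_powS (R : realType) (n : nat) (q : int -> quat R) (z : quat R) :
  z ^+ n = - powcomb n z q -> q 0 = 0 ->
  z ^+ n.+1 = powcomb n z (fun j => q j * q n%:Z - q (j - 1)).
Proof.
move=> hz q0.
rewrite exprS hz mulrN (powcomb_shift _ _ _ _ _ hz q0) /powcomb -sumrN.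
by apply: eq_bigr => i _; rewrite -mulrN opprB.
Qed.

Lemma zero_powSS (R : realType) (n : nat) (q : int -> quat R) (z : quat R) :
  z ^+ n = - powcomb n z q -> q 0 = 0 -> q (-1) = 0 ->
  z ^+ n.+2 = powcomb n z (fun j => q j * q (n%:Z - 1) - q j * q n%:Z ^+ 2
                                    + q (j - 1) * q n%:Z - q (j - 2)).
Proof.
move=> hz q0 qm1; rewrite exprS (zero_powS _ _ _ _ hz q0).
rewrite (powcomb_shift _ _ _ _ _ hz); last by rewrite sub0r q0 qm1 mul0r subr0.
apply: eq_bigr => i _; congr (_ * _).
rewrite -[_ - 1 - 1]addrA -opprD mulrBr -expr2 opprB.
by rewrite [LHS]addrC addrA.
Qed.

(** * Sums of powers *)

(** Shifting a geometric sum by three loses [1 + x + x^2] and gains the three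
    top powers. *)
Lemma expr3_geom_le (R : realType) (n : nat) (x : R) : 0 <= x ->
  x ^+ 3 * (\sum_(i < n) x ^+ i) <=
  \sum_(i < n) x ^+ i + (x ^+ n + x ^+ n.+1 + x ^+ n.+2).
Proof.
move=> x0.
have -> : \sum_(i < n) x ^+ i + (x ^+ n + x ^+ n.+1 + x ^+ n.+2) =
          1 + x + x ^+ 2 + x ^+ 3 * \sum_(i < n) x ^+ i.
  transitivity (\sum_(i < 3 + n) x ^+ i).
    by rewrite addnC !addnS addn0 !big_ord_recr /= !addrA.
  rewrite big_split_ord /= !big_ord_recr big_ord0 /= add0r expr0 expr1.
  by rewrite mulr_sumr; under [in RHS]eq_bigr do rewrite -exprD.
by rewrite lerDr !addr_ge0 ?exprn_ge0.
Qed.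

Lemma geom_gt0 (R : realType) (n : nat) (x : R) : 0 <= x -> (0 < n)%N ->
  0 < \sum_(i < n) x ^+ i.
Proof.
case: n => // n x0 _; rewrite big_ord_recl expr0 ltr_pwDl //.
by apply: sumr_ge0 => i _; apply: exprn_ge0.
Qed.

(** * The bound on the zeros *)

Theorem theorem2 (R : realType) (n : nat) (q : int -> quat R) (z : quat R)
    (hn : (3 <= n)%N) (hqm1 : q (-1) = 0) (hq0 : q 0 = 0) (hq1 : q 1 <> 0)
    (hz : fr n q z = 0) :
  qnorm z <=
    powR (1 + alpha n q + beta n q + \sum_(1 <= j < n.+1) qnorm (q j%:Z) ^+ 2)
         (6%:R^-1).
Proof.
set T := (X in powR X _).
have hzn := fr_eq0 _ _ _ _ hz.
have z0 := normsq_ge0 _ z.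
pose S := \sum_(i < n) normsq z ^+ i.
have Sgt0 : 0 < S by apply: geom_gt0 => //; apply: leq_trans hn.
have zT : normsq z ^+ 3 <= T.
  rewrite -(ler_pM2r Sgt0).
  apply: le_trans (expr3_geom_le _ n _ z0) _.
  have -> : T * S = S + (S * \sum_(1 <= j < n.+1) qnorm (q j%:Z) ^+ 2
                         + S * beta n q + S * alpha n q).
    by rewrite /T; ring.
  rewrite -/S lerD2l -!normsqX.
  apply: lerD; first apply: lerD.
  - rewrite hzn normsqN; under eq_bigr do rewrite qnorm_sqr.
    exact: normsq_powcomb.
  - rewrite (zero_powS _ _ _ _ hzn hq0) /beta.
    under eq_bigr do rewrite qnorm_sqr.
    exact: normsq_powcomb.
  - rewrite (zero_powSS _ _ _ _ hzn hq0 hqm1) /alpha.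
    under eq_bigr do rewrite qnorm_sqr.
    exact: normsq_powcomb.
have nz0 : 0 <= qnorm z by apply: sqrtr_ge0.
have -> : qnorm z = powR (normsq z ^+ 3) 6%:R^-1.
  rewrite -qnorm_sqr -exprM -powR_mulrn // -powRrM mulfV ?pnatr_eq0 //.
  by rewrite powRr1.
have cube_ge0 : 0 <= normsq z ^+ 3 by apply: exprn_ge0.
by apply: ge0_ler_powR; rewrite ?nnegrE ?invr_ge0 ?ler0n //; apply: le_trans zT.
Qed.
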